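(* Let $X$ be a nonempty set, $\phi$ a self-map of $X$, $E^\phi=\{(x,y)\in X\times X: x=\phi(y)\}$, and let $\eta\in\mathbb N\cup\{\infty\}$. Then the following two conditions are equivalent: (i) the directed graph $(X,E^\phi)$ is connected and there exists $\omega\in X$ such that $\mathrm{card}(\phi^{-1}(\{\omega\}))=\eta+1$ and $\mathrm{card}(\phi^{-1}(\{x\}))=1$ for every $x\in X\setminus\{\omega\}$, (ii) one of the following two conditions is satisfied: (ii-a) there exist $\kappa\in\mathbb Z_+$ and two disjoint systems $\{x_i\}_{i=0}^\kappa$ and $\{x_{i,j}\}_{i\in J_\eta,\,j\in\mathbb N}$ of distinct points of $X$ such that $X=\{x_0,\ldots,x_\kappa\}\cup\{x_{i,j}: i\in J_\eta,\ j\in\mathbb N\}$ and $$\phi(x)=\begin{cases}x_{i,j-1}&\text{if }x=x_{i,j}\text{ with }i\in J_\eta\text{ and }j\ge2,\\ x_\kappa&\text{if }x=x_{i,1}\text{ with }i\in J_\eta\text{ or }x=x_0,\\ x_{i-1}&\text{if }x=x_i\text{ with }i\in J_\kappa,\end{cases}$$ (ii-b) there exist two disjoint systems $\{x_i\}_{i=0}^\infty$ and $\{x_{i,j}\}_{i\in J_{\eta+1},\,j\in\mathbb N}$ of distinct points of $X$ such that $X=\{x_i:i\in\mathbb Z_+\}\cup\{x_{i,j}:i\in J_{\eta+1},\ j\in\mathbb N\}$ and $$\phi(x)=\begin{cases}x_{i,j-1}&\text{if }x=x_{i,j}\text{ with }i\in J_{\eta+1}\text{ and }j\ge2,\\ x_0&\text{if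 }x=x_{i,1}\text{ with }i\in J_{\eta+1},\\ x_{i+1}&\text{if }x=x_i\text{ with }i\in\mathbb Z_+.\end{cases}$$
   Context: Notation: $\mathbb N=\{1,2,\ldots\}$, $\mathbb Z_+=\{0,1,2,\ldots\}$, $J_k=\{i\in\mathbb N:i\le k\}$ for $k\in\mathbb Z_+\cup\{\infty\}$ ($J_0=\emptyset$, $J_\infty=\mathbb N$). When $\eta=\infty$, $\eta+1=\infty$ and $\mathrm{card}(\cdot)=\infty$ means countably infinite. A directed graph $(V,E)$ (with $E\subseteq V\times V$) is connected if for every pair $(u,v)$ of distinct vertices there is a finite sequence $u_1=u,u_2,\ldots,u_k=v$ of vertices with $k\ge2$ such that for every $i\in J_{k-1}$ either $(u_i,u_{i+1})\in E$ or $(u_{i+1},u_i)\in E$. *)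

(* Defs.v *)
From mathcomp Require Import all_boot.
From mathcomp Require Import mathcomp_extra boolp classical_sets functions cardinality.

Set Implicit Arguments.
Unset Strict Implicit.
Unset Printing Implicit Defensive.

Local Open Scope classical_set_scope.

Variant enat := Fin of nat | Infty.

Definition esucc (k : enat) : enat :=
  if k is Fin n then Fin n.+1 else Infty.

(* Indices start at 1: J (Fin 0) is empty and J Infty is {1, 2, ...}. *)
Definition J (k : enat) : set nat :=
  [set i | 0 < i /\ (if k is Fin n then i <= n else true)].

(* has_card A Infty says that A is countably infinite. *)
Definition has_card (T : Type) (A : set T) (k : enat) : Prop := (A #= J k)%card.

Definition digraph_connected (V : Type) (E : set (V * V)) : Prop :=
  forall u v : V, u <> v ->
  exists (k : nat) (s : nat -> V),
    [/\ 2 <= k, s 1 = u, s k = v &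
        forall i, J (Fin k.-1) i -> E (s i, s i.+1) \/ E (s i.+1, s i)].

Definition graph_edges (X : Type) (phi : X -> X) : set (X * X) :=
  [set p | p.1 = phi p.2].

(* Main.v *)
Require Import Defs.
From mathcomp Require Import all_boot.
From mathcomp Require Import mathcomp_extra boolp classical_sets functions cardinality.

Set Implicit Arguments.
Unset Strict Implicit.
Unset Printing Implicit Defensive.

Local Open Scope classical_set_scope.

(** Write O for the forward orbit of the branching point omega.

    Since an edge joins each point to its image, two points are connected in
    the graph exactly when their forward orbits meet; connectedness therefore
    says that every forward orbit enters O [digraph_connectedP].

    Suppose every fibre away from omega is a singleton. Then the forward orbit
    of a point off O can reach O only through omega [forward_orbit_entrance]:
    it passes through a preimage w of omega that is off O and goes to omega
    next. Before reaching w it visits only points with a single preimage, so it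
    can be retraced backwards from w. Hence X is the disjoint union of O and of
    one backward ray w, psi w, psi (psi w), ... for each preimage w of omega off
    O, where psi is a section of phi [attached_rays_exist]. Conversely, any such
    decomposition determines the fibres of phi and makes the graph connected, as
    soon as phi is injective on O.

    What remains is the shape of O. If omega is periodic of minimal period
    kappa + 1, then O is a cycle of that length, exactly one of the eta + 1
    preimages of omega lies on it, and there are eta rays: this is case (a),
    where the points of the cycle are numbered against the direction of phi. If
    omega is not periodic, then O is an injective sequence containing no
    preimage of omega, and all eta + 1 preimages start rays: this is case (b).
    The two counts agree because removing a point from a set of cardinality
    eta + 1 leaves one of cardinality eta, also when eta is infinite
    [has_card_setD1]. *)

(** * Cardinalities modelled on initial segments *)

Lemma J_esucc (k : enat) (i : nat) : J (esucc k) i.+1 <-> i = 0 \/ J k i.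
Proof.
split=> [[_ Ji]|[->|[i0 Ji]]].
- case: i Ji => [|i] Ji; first by left.
  by right; split=> //; case: k Ji.
- by split=> //; case: k.
- by split=> //; case: k Ji.
Qed.

Lemma has_cardP (T : Type) (t0 : T) (A : set T) (k : enat) :
  has_card A k <-> exists g : nat -> T, set_bij (J k) A g.
Proof.
rewrite /has_card card_eq_sym; elim/Ppointed: T => T in A t0 *.
  by case: (no t0).
by split=> [/card_set_bijP|?]; last exact/card_set_bijP.
Qed.

(** Counting along a bijection with an initial segment, removing a point shifts
    the indices down by one; swapping the value at index 1 with the removed
    point lets that point be arbitrary. *)
Lemma has_card_setD1 (T : Type) (A : set T) (k : enat) (a : T) :
  A a -> has_card A (esucc k) <-> has_card (A `\ a) k.
Proof.
move=> Aa; split=> /(has_cardP a)[g [gA gi gs]]; apply/(has_cardP a).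
- have [t Jt gt] := gs a Aa.
  have J1 : J (esucc k) 1 by apply/J_esucc; left.
  have Js i : J k i -> J (esucc k) i.+1 by move=> ?; apply/J_esucc; right.
  exists (fun i => if i.+1 == t then g 1 else g i.+1); split.
  + move=> i Ji; case: eqP => it; split; try exact/gA/Js; try exact/gA.
      move=> /= g1; have := gi t 1 (mem_set Jt) (mem_set J1).
      by rewrite gt g1 -it => /(_ erefl)[i0]; case: Ji; rewrite i0.
    move=> /= gia; apply: it.
    by apply: gi; rewrite ?inE ?gt //; apply: Js.
  + move=> i j /set_mem Ji /set_mem Jj.
    have i0 : 0 < i by case: Ji.
    have j0 : 0 < j by case: Jj.
    have inj1 l : J k l -> g 1 <> g l.+1.
      move=> Jl /(gi _ _ (mem_set J1) (mem_set (Js _ Jl)))[l0].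
      by case: Jl; rewrite -l0.
    case: eqP => it; case: eqP => jt.
    * by rewrite -jt in it; case: it.
    * by move/inj1; case.
    * by move/esym/inj1; case.
    * by move/(gi _ _ (mem_set (Js _ Ji)) (mem_set (Js _ Jj)))=> [].
  + move=> x [Ax xa]; have [[|s] Js' gx] := gs x Ax; first by case: Js'.
    move/J_esucc: Js' => [s0|Jks].
      subst s; case: t Jt gt => [|t] Jt gt; first by case: Jt.
      move/J_esucc: Jt => [t0|Jkt]; first by case: xa; rewrite -gx -gt t0.
      by exists t => //; rewrite eqxx.
    exists s => //; case: eqP => // st.
    by case: xa; rewrite -gx st.
- exists (fun i => if i <= 1 then a else g i.-1); split.
  + move=> [|[|i]] // /J_esucc[] // Ji.
    by case: (gA _ Ji).
  + move=> [|[|i]] [|[|j]] /set_mem Ji /set_mem Jj //=;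
      try (by case: Ji); try (by case: Jj).
      by move/J_esucc: Jj => [] // /gA[_ gj] /esym.
      by move/J_esucc: Ji => [] // /gA[_ gj].
    move/J_esucc: Ji => [] // Ji; move/J_esucc: Jj => [] // Jj.
    by move=> /(gi _ _ (mem_set Ji) (mem_set Jj))[->].
  + move=> x Ax; have [->|xa] := pselect (x = a).
      by exists 1 => //; apply/J_esucc; left.
    have [i Ji gx] := gs x (conj Ax xa).
    exists i.+1; first by apply/J_esucc; right.
    by case: i Ji gx => [[]|].
Qed.

Lemma has_card0 (T : Type) (A : set T) : has_card A (Fin 0) <-> A = set0.
Proof.
have -> : has_card A (Fin 0) = (A #= @set0 nat)%card :> Prop.
  rewrite /has_card; congr (is_true (card_eq _ _)); rewrite -subset0.
  by move=> [|i] [].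
by rewrite card_eq0; split=> [/eqP|->].
Qed.

Lemma has_card_nonempty (T : Type) (A : set T) (k : enat) :
  has_card A (esucc k) -> A !=set0.
Proof.
move=> Ak; apply/set0P/eqP => A0; move: Ak.
rewrite A0 /has_card card_eq_sym card_eq0 => /eqP J0.
suff: @set0 nat 1 by [].
by rewrite -J0; apply/J_esucc; left.
Qed.

Lemma has_card1 (T : Type) (A : set T) :
  has_card A (Fin 1) <-> exists a, A = [set a].
Proof.
have D1 a : A a -> has_card A (Fin 1) <-> A `\ a = set0.
  by move=> Aa; rewrite -has_card0; exact: (@has_card_setD1 _ _ (Fin 0)).
split=> [A1|[a Aa]]; last by apply/(D1 a); rewrite Aa // setDv.
have [a Aa] := @has_card_nonempty _ _ (Fin 0) A1; exists a.
have /seteqP[Da _] : A `\ a = set0 by apply/D1.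
apply/seteqP; split=> x; last by move=> ->.
by move=> Ax; have [//|xa] := pselect (x = a); case: (Da x).
Qed.

(** * Connectedness and confluence of orbits *)

Lemma digraph_connectedP (X : Type) (phi : X -> X) :
  digraph_connected (graph_edges phi) <->
  forall u v, exists m n, iter m phi u = iter n phi v.
Proof.
split=> [conn u v|conf u v uv].
- have [->|uv] := pselect (u = v); first by exists 0, 0.
  have [k [s [k2 s1 sk edge]]] := conn u v uv.
  suff H : forall i, i <= k.-1 ->
      exists m n, iter m phi u = iter n phi (s i.+1).
    by have := H k.-1 (leqnn _); rewrite (prednK (ltnW k2)) sk.
  elim=> [_|i IH ik]; first by exists 0, 0; rewrite s1.
  have [m [n mn]] := IH (ltnW ik).
  have [e|e] : s i.+1 = phi (s i.+2) \/ s i.+2 = phi (s i.+1).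
    exact: edge i.+1 (conj isT ik).
    by exists m, n.+1; rewrite mn iterSr -e.
  by exists m.+1, n; rewrite iterS mn -iterS iterSr -e.
- have [m [n mn]] := conf u v.
  (* Climb from u to the common iterate, then descend along the orbit of v. *)
  exists (m + n).+1.
  exists (fun i =>
    if i <= m.+1 then iter i.-1 phi u else iter ((m + n).+1 - i) phi v).
  split=> //=.
  + rewrite ltnS lt0n; apply/eqP => mn0; apply: uv.
    by move: mn; have [-> ->] : m = 0 /\ n = 0 by case: m n mn0 => [|m] [|n].
  + rewrite ltnS subnn; case: ifP => //.
    case: n mn => [|n] mn; first by rewrite addn0 mn.
    by rewrite addnS ltnNge leq_addr.
  + move=> [|i] [//= _ iN]; rewrite /graph_edges /= !ltnS.
    have [im|mi|im] := ltngtP i m.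
    * by right.
    * by left; rewrite /= -iterS !subSS -subSn.
    * left; rewrite im !subSS in iN *.
      by rewrite mn -iterS -subSn // subSS addKn.
Qed.

(** * Attaching rays to an orbit *)

Definition forward_orbit (X : Type) (phi : X -> X) (omega : X) : set X :=
  [set iter n phi omega | n in [set: nat]].

(** The i-th ray is y (i, 1), y (i, 2), ..., listed away from omega, so that phi
    moves along it towards omega. *)
Definition attached_rays (X : Type) (phi : X -> X) (omega : X) (I : set nat)
    (y : nat * nat -> X) : Prop :=
  [/\ set_inj (I `*` J Infty) y,
      forward_orbit phi omega `&` y @` (I `*` J Infty) = set0,
      [set: X] = forward_orbit phi omega `|` y @` (I `*` J Infty),
      forall i j, I i -> 2 <= j -> phi (y (i, j)) = y (i, j.-1) &
      forall i, I i -> phi (y (i, 1)) = omega].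

Lemma forward_orbit_root (X : Type) (phi : X -> X) (omega : X) :
  forward_orbit phi omega omega.
Proof. by exists 0. Qed.

Lemma forward_orbit_step (X : Type) (phi : X -> X) (omega x : X) :
  forward_orbit phi omega x -> forward_orbit phi omega (phi x).
Proof. by move=> [n _ <-]; exists n.+1. Qed.

Lemma forward_orbit_iter (X : Type) (phi : X -> X) (omega x : X) (n : nat) :
  forward_orbit phi omega x -> forward_orbit phi omega (iter n phi x).
Proof. by move=> Ox; elim: n => // n; exact: forward_orbit_step. Qed.

(** An orbit that enters the orbit of the branching point must enter it through
    the branching point, because the points of the orbit other than omega have
    their only preimage already inside the orbit. *)
Lemma forward_orbit_entrance (X : Type) (phi : X -> X) (omega x : X) :
  (forall u v, phi u = phi v -> phi u <> omega -> u = v) ->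
  ~ forward_orbit phi omega x -> forward_orbit phi omega (phi x) ->
  phi x = omega.
Proof.
move=> inj xO [n _ nx]; have [//|xw] := pselect (phi x = omega).
case: n nx => [|n] nx; first by rewrite -nx.
by case: xO; rewrite (inj x (iter n phi omega)) //; exists n.
Qed.

(** The rays are the backward orbits, under a section of phi, of the preimages
    of omega lying off its orbit. *)
Lemma attached_rays_exist (X : Type) (phi : X -> X) (omega : X) (I : set nat)
    (g : nat -> X) :
  (forall u, exists m n, iter m phi u = iter n phi omega) ->
  (forall u v, phi u = phi v -> phi u <> omega -> u = v) ->
  (forall u, exists v, phi v = u) ->
  set_bij I (phi @^-1` [set omega] `\` forward_orbit phi omega) g ->
  exists y, attached_rays phi omega I y.
Proof.
move=> conf inj /choice[psi psiK] [gA gi gs].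
pose O := forward_orbit phi omega.
have iterK n u : iter n phi (iter n psi u) = u.
  by elim: n u => // n IH u; rewrite iterSr /= psiK IH.
have offO n u : ~ O u -> ~ O (iter n psi u).
  by move=> uO /(forward_orbit_iter n); rewrite iterK.
(* Equal points of two rays sit at equal depths: otherwise applying phi often
   enough puts omega itself on a ray. *)
have iterO m n u v : phi u = omega -> ~ O v -> m < n ->
    iter m psi u = iter n psi v -> False.
  move=> uw vO mn e; have := congr1 (iter m phi) e.
  rewrite iterK -(subnKC mn) addSnnS iterD iterK => e'.
  have := congr1 phi e'; rewrite uw /= psiK => e2.
  by apply: (offO (n - m.+1) v vO); rewrite -e2; exact: forward_orbit_root.
exists (fun p => iter p.2.-1 psi (g p.1)); split.
- move=> [i j] [i' j'] /set_mem[/= Ii [j0 _]] /set_mem[/= Ii' [j'0 _]].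
  have [/= giw giO] := gA _ Ii; have [/= gi'w gi'O] := gA _ Ii'.
  have [jj|jj|jj] := ltngtP j.-1 j'.-1.
  + by move/(iterO _ _ _ _ giw gi'O jj).
  + by move/esym/(iterO _ _ _ _ gi'w giO jj).
  + rewrite jj => /(congr1 (iter j'.-1 phi)); rewrite !iterK => gg.
    congr pair; first by apply: gi; rewrite ?inE.
    by rewrite -(prednK j0) jj prednK.
- rewrite -subset0 => x [Ox [[i j] [/= Ii _] xE]]; move: Ox; rewrite -xE => Ox.
  by apply: offO Ox; case: (gA _ Ii).
- apply/seteqP; split=> // v _.
  (* The last point before the first entrance into O is the root of the ray
     through v. *)
  have ex_m : exists m, `[< O (iter m phi v) >].
    by have [m [n mn]] := conf v; exists m; apply/asboolP; rewrite mn; exists n.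
  case: (ex_minnP ex_m) => -[|m] /asboolP mO min_m; first by left.
  right.
  have below k : k <= m -> ~ O (iter k phi v).
    by move=> km /asboolP/min_m; rewrite ltnNge km.
  have mw : phi (iter m phi v) = omega.
    by apply: forward_orbit_entrance => //; exact: below.
  have [i Ii gv] := gs (iter m phi v) (conj mw (below _ (leqnn m))).
  exists (i, m.+1); first by split.
  rewrite /= gv; elim: m {mw gv mO min_m} below => // m IH below.
  rewrite iterSr -[RHS]IH; last by move=> k /leqW; exact: below.
  congr (iter m psi _); apply: inj; rewrite psiK //= => e.
  by apply: (below m.+1) => //; rewrite iterS e; exact: forward_orbit_root.
- by move=> i [|[|j]] // Ii _ /=; rewrite psiK.
- by move=> i Ii /=; have [] := gA _ Ii.
Qed.

Section AttachedRays.

Variables (X : Type) (phi : X -> X) (omega : X) (I : set nat).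
Variables (y : nat * nat -> X).
Hypothesis rays : attached_rays phi omega I y.

Let O := forward_orbit phi omega.

Lemma attached_raysP (x : X) :
  O x \/ exists i j, I i /\ x = y (i, j.+1).
Proof.
have [_ _ cover _ _] := rays.
have : [set: X] x by []; rewrite cover => -[|[[i [|j]] [/= Ii [j0 _]] <-]] //.
  by left.
by right; exists i, j.
Qed.

Lemma attached_rays_off_orbit (i j : nat) : I i -> ~ O (y (i, j.+1)).
Proof.
have [_ /seteqP[disj _] _ _ _] := rays => Ii Oy.
by apply: (disj (y (i, j.+1))); split=> //; exists (i, j.+1).
Qed.

Lemma attached_rays_inj (i j i' j' : nat) :
  I i -> I i' -> y (i, j.+1) = y (i', j'.+1) -> i = i' /\ j = j'.
Proof.
have [inj _ _ _ _] := rays => Ii Ii' /inj.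
by rewrite !inE => /(_ (conj Ii (conj isT isT)) (conj Ii' (conj isT isT)))[-> ->].
Qed.

Lemma attached_rays_connected : digraph_connected (graph_edges phi).
Proof.
have [_ _ _ step root] := rays.
have conf u : exists m n, iter m phi u = iter n phi omega.
  have [[n _ <-]|[i [j [Ii ->]]]] := attached_raysP u; first by exists 0, n.
  exists j.+1, 0; elim: j => [|j IH]; first exact: root.
  by rewrite iterSr step.
apply/digraph_connectedP => u v.
have [a [b ab]] := conf u; have [c [d cd]] := conf v.
exists (d + a), (b + c).
by rewrite !iterD ab cd -!iterD addnC.
Qed.

Lemma attached_rays_root_fibre :
  phi @^-1` [set omega] `\` O = (fun i => y (i, 1)) @` I.
Proof.
have [_ _ _ step root] := rays.
apply/seteqP; split=> x.
- move=> [/= xw xO]; have [//|[i [[|j] [Ii xy]]]] := attached_raysP x.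
    by exists i.
  case: (@attached_rays_off_orbit i j Ii).
  by rewrite -[j.+1]/(j.+2.-1) -step // -xy xw; exact: forward_orbit_root.
- move=> [i Ii <-]; split; first exact: root.
  exact: attached_rays_off_orbit.
Qed.

Lemma attached_rays_card (k : enat) :
  I = J k -> has_card (phi @^-1` [set omega] `\` O) k.
Proof.
move=> Ik; rewrite attached_rays_root_fibre Ik; apply: inj_card_eq.
move=> i j; rewrite -Ik => /set_mem Ii /set_mem Ij.
by move/(attached_rays_inj Ii Ij) => [].
Qed.

(** On a ray, the preimage is the next point outwards. On O it is the previous
    point of the orbit: a point of a ray cannot be a second preimage, since phi
    sends it to omega or to a point off O, and another point of O cannot be one
    either, by injectivity. *)
Lemma attached_rays_fibre1 (x : X) :
  set_inj O phi -> x <> omega -> has_card (phi @^-1` [set x]) (Fin 1).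
Proof.
have [_ _ _ step root] := rays => inj xw; apply/has_card1.
have [Ox|[i [j [Ii ->]]]] := attached_raysP x.
- have [[|n] _ nx] := Ox; first by case: xw.
  exists (iter n phi omega); apply/seteqP; split=> u /=; last by move=> ->.
  have [Ou ux|[i [[|j] [Ii ->]]]] := attached_raysP u.
  + by apply: inj; rewrite ?inE; [|exists n|rewrite ux -nx].
  + by rewrite root // => /esym.
  + by rewrite step // => e; case: (@attached_rays_off_orbit i j Ii); rewrite e.
- exists (y (i, j.+2)); apply/seteqP; split=> u /=; last by move=> ->; rewrite step.
  have [Ou ux|[i' [[|j'] [Ii' ->]]]] := attached_raysP u.
  + by case: (@attached_rays_off_orbit i j Ii); rewrite -ux; exact: forward_orbit_step.
  + rewrite root // => e; case: (@attached_rays_off_orbit i j Ii).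
    by rewrite -e; exact: forward_orbit_root.
  + by rewrite step // => /(attached_rays_inj Ii' Ii)[-> ->].
Qed.

End AttachedRays.

(** * Periodic and injective orbits *)

Lemma forward_orbit_periodic (X : Type) (phi : X -> X) (omega : X) (n : nat) :
  iter n.+1 phi omega = omega ->
  forward_orbit phi omega = [set iter i phi omega | i in [set i | i <= n]].
Proof.
move=> per; apply/seteqP; split=> x [m]; last by move=> _ <-; exists m.
move=> _ <-; elim: m => [|m [i /= + <-]]; first by exists 0.
rewrite leq_eqVlt => /predU1P[->|ilt]; last by exists i.+1.
by exists 0; rewrite // -per.
Qed.

(** If two iterates coincide, completing the later one to a full period brings
    the earlier one back to omega too soon. *)
Lemma iter_minimal_period_inj (X : Type) (phi : X -> X) (omega : X) (n : nat) :
  iter n.+1 phi omega = omega ->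
  (forall i, i < n -> iter i.+1 phi omega <> omega) ->
  set_inj [set i | i <= n] (fun i => iter i phi omega).
Proof.
move=> per min_n.
suff ne a b : a < b -> b <= n -> iter a phi omega <> iter b phi omega.
  move=> a b /set_mem an /set_mem bn.
  have [ab|ba|//] := ltngtP a b.
    by move/(ne _ _ ab bn).
  by move/esym/(ne _ _ ba an).
move=> ab bn /(congr1 (iter (n.+1 - b) phi)); rewrite -!iterD subnK ?leqW // per.
rewrite subSn // addSn; apply: min_n.
by rewrite -[ltnRHS](subnK bn) ltn_add2l.
Qed.

(** A coincidence between two iterates can be pulled back step by step, through
    fibres that are singletons because omega is never revisited, until it
    becomes a return to omega. *)
Lemma iter_nonperiodic_inj (X : Type) (phi : X -> X) (omega : X) :
  (forall u v, phi u = phi v -> phi u <> omega -> u = v) ->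
  (forall n, iter n.+1 phi omega <> omega) ->
  injective (fun i => iter i phi omega).
Proof.
move=> inj aper; elim=> [|a IH] [|b] //=.
- by move/esym/(aper b).
- by move/(aper a).
- by move/inj => /(_ (aper a))/IH ->.
Qed.

(** * The two shapes of the map *)

Lemma rev_range_image (T : Type) (f : nat -> T) (n : nat) :
  [set f (n - i) | i in [set i | i <= n]] = f @` [set i | i <= n].
Proof.
apply/seteqP; split=> x [i /= ik <-]; exists (n - i) => //=; rewrite ?leq_subr //.
by rewrite subKn.
Qed.

Lemma fibre1_inj (X : Type) (phi : X -> X) (omega : X) :
  (forall x, x <> omega -> has_card (phi @^-1` [set x]) (Fin 1)) ->
  forall u v, phi u = phi v -> phi u <> omega -> u = v.
Proof.
move=> fib u v uv /fib/has_card1[a /seteqP[fa _]].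
by rewrite [u]fa // [v]fa.
Qed.

Theorem theorem3p2p1 (X : Type) (hX : inhabited X) (phi : X -> X)
    (eta : enat) (heta : eta <> Fin 0) :
  (digraph_connected (graph_edges phi) /\
   exists omega : X,
     has_card (phi @^-1` [set omega]) (esucc eta) /\
     forall x : X, x <> omega -> has_card (phi @^-1` [set x]) (Fin 1))
  <->
  ((exists (kappa : nat) (x : nat -> X) (y : nat * nat -> X),
     [/\ set_inj [set i | i <= kappa] x,
         set_inj (J eta `*` J Infty) y,
         x @` [set i | i <= kappa] `&` y @` (J eta `*` J Infty) = set0,
         [set: X] = x @` [set i | i <= kappa] `|` y @` (J eta `*` J Infty) &
         [/\ forall i j, J eta i -> 2 <= j -> phi (y (i, j)) = y (i, j.-1),
             forall i, J eta i -> phi (y (i, 1)) = x kappa,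
             phi (x 0) = x kappa &
             forall i, J (Fin kappa) i -> phi (x i) = x i.-1]])
   \/
   (exists (x : nat -> X) (y : nat * nat -> X),
     [/\ set_inj [set: nat] x,
         set_inj (J (esucc eta) `*` J Infty) y,
         x @` [set: nat] `&` y @` (J (esucc eta) `*` J Infty) = set0,
         [set: X] = x @` [set: nat] `|` y @` (J (esucc eta) `*` J Infty) &
         [/\ forall i j, J (esucc eta) i -> 2 <= j ->
               phi (y (i, j)) = y (i, j.-1),
             forall i, J (esucc eta) i -> phi (y (i, 1)) = x 0 &
             forall i, phi (x i) = x i.+1]])).
Proof.
split.
- move=> [conn [omega [card_omega fib]]].
  have conf u := (digraph_connectedP phi).1 conn u omega.
  have inj := fibre1_inj fib.
  have surj u : exists v, phi v = u.
    have [->|/fib] := pselect (u = omega).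
      exact: has_card_nonempty card_omega.
    exact: (@has_card_nonempty _ _ (Fin 0)).
  have [per|aper] := pselect (exists n, iter n.+1 phi omega = omega).
  + left.
    have ex_n : exists n, `[< iter n.+1 phi omega = omega >].
      by have [n pn] := per; exists n; apply/asboolP.
    case: (ex_minnP ex_n) => kappa /asboolP perk min_k.
    have min_kappa i : i < kappa -> iter i.+1 phi omega <> omega.
      by move=> ik /asboolP/min_k; rewrite leqNgt ik.
    have injk := iter_minimal_period_inj perk min_kappa.
    have OE := forward_orbit_periodic perk.
    (* Minimality of the period leaves a single preimage of omega on the
       cycle. *)
    have rootE : phi @^-1` [set omega] `\` forward_orbit phi omega =
        phi @^-1` [set omega] `\ iter kappa phi omega.
      apply/seteqP; split=> u [/= uw uO]; split=> //.
        by move=> uk; apply: uO; rewrite uk; exists kappa.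
      rewrite OE => -[i /= ik iu]; apply: uO; rewrite -iu.
      move: ik; rewrite leq_eqVlt => /predU1P[->//|/min_kappa].
      by rewrite iterS iu.
    have : has_card (phi @^-1` [set omega] `\ iter kappa phi omega) eta.
      exact/has_card_setD1.
    rewrite -rootE => /(has_cardP omega)[g gbij].
    have [y [yinj disj cover step root]] :=
      attached_rays_exist conf inj surj gbij.
    exists kappa, (fun i => iter (kappa - i) phi omega), y.
    rewrite rev_range_image -OE; split=> //; last first.
      split=> //.
      - by move=> i Ji; rewrite subnn; exact: root.
      - by rewrite subnn subn0.
      - by move=> [|i] [//= _ ik]; rewrite -iterS -subSn // subSS.
    move=> i j /set_mem /= ik /set_mem /= jk e.
    have : kappa - i = kappa - j.
      by apply: injk e; rewrite inE /= leq_subr.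
    by move=> /(congr1 (subn kappa)); rewrite !subKn.
  + right.
    have inj_iter := iter_nonperiodic_inj inj (fun n e => aper (ex_intro _ n e)).
    have rootE : phi @^-1` [set omega] `\` forward_orbit phi omega =
        phi @^-1` [set omega].
      apply/seteqP; split=> u; first by case.
      move=> /= uw; split=> // -[n _ nu]; apply: aper.
      by exists n; rewrite iterS nu.
    move: card_omega; rewrite -rootE => /(has_cardP omega)[g gbij].
    have [y [yinj disj cover step root]] :=
      attached_rays_exist conf inj surj gbij.
    exists (fun i => iter i phi omega), y; split=> //.
    by move=> i j _ _; exact: inj_iter.
- case=> [[kappa [x [y [xinj yinj disj cover [step root x0 xS]]]]]|].
  + have xsub i : i <= kappa -> iter i phi (x kappa) = x (kappa - i).
      elim: i => [|i IH] ik; first by rewrite subn0.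
      rewrite iterS IH 1?ltnW // xS; first by rewrite subnS.
      by split; rewrite /= ?subn_gt0 // leq_subr.
    have per : iter kappa.+1 phi (x kappa) = x kappa.
      by rewrite iterS xsub // subnn.
    have OE : forward_orbit phi (x kappa) = x @` [set i | i <= kappa].
      rewrite (forward_orbit_periodic per) -[RHS]rev_range_image.
      by apply/eq_imagel => i /= /xsub.
    have rays : attached_rays phi (x kappa) (J eta) y.
      by rewrite /attached_rays OE.
    have injO : set_inj (forward_orbit phi (x kappa)) phi.
      rewrite OE => _ _ /set_mem[i /= ik <-] /set_mem[j /= jk <-].
      case: i j ik jk => [|i] [|j] ik jk //.
      * rewrite x0 xS // => /xinj; rewrite !inE /= => /(_ (leqnn _) (ltnW jk)) kj.
        by rewrite kj ltnn in jk.
      * rewrite x0 xS // => /xinj; rewrite !inE /= => /(_ (ltnW ik) (leqnn _)) ki.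
        by rewrite -ki ltnn in ik.
      * rewrite !xS //= => /xinj; rewrite !inE /=.
        by move=> /(_ (ltnW ik) (ltnW jk)) ->.
    split; first exact: attached_rays_connected rays.
    exists (x kappa); split; last first.
      by move=> u; exact: attached_rays_fibre1 rays _ injO.
    (* By injectivity on the cycle, x 0 is the only preimage of x kappa there. *)
    have rootE : phi @^-1` [set x kappa] `\ x 0 =
        phi @^-1` [set x kappa] `\` forward_orbit phi (x kappa).
      apply/seteqP; split=> u [/= uw uO]; split=> //.
        move=> Ou; apply: uO; apply: injO; rewrite ?inE ?uw ?x0 //.
        by rewrite OE; exists 0.
      by move=> u0; apply: uO; rewrite u0 OE; exists 0.
    apply/(has_card_setD1 eta (a := x 0)) => //; rewrite rootE.
    exact: attached_rays_card rays _ erefl.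
  + move=> [x [y [xinj yinj disj cover [step root xS]]]].
    have xiter i : iter i phi (x 0) = x i by elim: i => //= i ->.
    have OE : forward_orbit phi (x 0) = x @` [set: nat].
      by apply/eq_imagel => i _; exact: xiter.
    have rays : attached_rays phi (x 0) (J (esucc eta)) y.
      by rewrite /attached_rays OE.
    have injx i j : x i = x j -> i = j by move/xinj; rewrite !inE; apply.
    have injO : set_inj (forward_orbit phi (x 0)) phi.
      rewrite OE => _ _ /set_mem[i _ <-] /set_mem[j _ <-].
      by rewrite !xS => /injx[->].
    split; first exact: attached_rays_connected rays.
    exists (x 0); split; last first.
      by move=> u; exact: attached_rays_fibre1 rays _ injO.
    have <- : phi @^-1` [set x 0] `\` forward_orbit phi (x 0) =
        phi @^-1` [set x 0].
      apply/seteqP; split=> u; first by case.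
      move=> /= uw; split=> //; rewrite OE => -[i _ iu].
      by move: uw; rewrite -iu xS => /injx.
    exact: attached_rays_card rays _ erefl.
Qed.
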